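(* Let $\gamma\in(0,1)$, $\mathsf{u}_0\in\mathcal{H}$, $f\in L^2(0,T;\mathcal{V}')$, $\mathcal{K}\in\mathbb{N}$ and $\tau=T/\mathcal{K}$. Consider the implicit semi-discrete scheme: $U^0=\mathsf{u}_0$ and, for $k=0,\dots,\mathcal{K}-1$, $U^{k+1}\in\mathcal{V}$ solves $$(\delta^\gamma U^{k+1},W)_{\mathcal{H}}+\langle\mathfrak{F}U^{k+1},W\rangle=\langle f^{k+1},W\rangle\qquad\forall W\in\mathcal{V}.$$ This scheme is unconditionally stable and satisfies $$I^{1-\gamma}\|U^\tau\|_{\mathcal{H}}^2(T)+\|U^\tau\|_{\ell^2(\mathcal{V})}^2\le I^{1-\gamma}\|U^0\|_{\mathcal{H}}^2(T)+\|f^\tau\|^2_{\ell^2(\mathcal{V}')}.$$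
   Context: $\mathcal{V}\subset\mathcal{H}\equiv\mathcal{H}'\subset\mathcal{V}'$ is a Gelfand triple of Hilbert spaces, $\mathfrak{F}:\mathcal{V}\to\mathcal{V}'$ is linear, continuous and coercive, $(\cdot,\cdot)_{\mathcal{H}}$ is the inner product of $\mathcal{H}$, $\langle\cdot,\cdot\rangle$ the duality pairing between $\mathcal{V}$ and $\mathcal{V}'$; norms are $\|U\|_{\mathcal{H}}=(U,U)_{\mathcal{H}}^{1/2}$, $\|U\|_{\mathcal{V}}=\langle\mathfrak{F}U,U\rangle^{1/2}$, and $\|\cdot\|_{\mathcal{V}'}$ is the dual norm of $\|\cdot\|_{\mathcal{V}}$. Let $T>0$, $t_k=k\tau$, $f^k=f(t_k)$, $a_j=(j+1)^{1-\gamma}-j^{1-\gamma}$. The discrete fractional derivative is $$\Gamma(2-\gamma)\,\delta^\gamma\phi^{k+1}=\sum_{j=0}^k a_j\,\tau^{-\gamma}(\phi^{k+1-j}-\phi^{k-j}).$$ For $\sigma>0$, $(I^\sigma g)(t)=\frac1{\Gamma(\sigma)}\int_0^t (t-r)^{\sigma-1}g(r)\,dr$. In $I^{1-\gamma}\|U^\tau\|^2_{\mathcal{H}}(T)$, the sequence $U^\tau=\{U^k\}_{k=0}^{\mathcal{K}}$ is identified with the piecewise constant function equal to $U^l$ on $(t_{l-1},t_l]$, $1\le l\le\mathcal{K}$; $I^{1-\gamma}\|U^0\|^2_{\mathcal{H}}(T)$ is $I^{1-\gamma}$ applied to the constant $\|U^0\|_{\mathcal{H}}^2$, evaluated at $T$.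 $\|\phi^\tau\|_{\ell^2(\mathcal{X})}^2=\sum_{k=1}^{\mathcal{K}}\tau\|\phi^k\|_{\mathcal{X}}^2$. ''Unconditionally stable'' means that the displayed bound holds with no restriction on $\tau$. *)

(* Defs.v *)
From HB Require Import structures.
From mathcomp Require Import all_boot all_order all_algebra sesquilinear.
From mathcomp Require Import all_classical all_reals all_analysis.
Import Order.TTheory GRing.Theory Num.Theory numFieldNormedType.Exports.

Set Implicit Arguments.
Unset Strict Implicit.
Unset Printing Implicit Defensive.

Local Open Scope classical_set_scope.
Local Open Scope ring_scope.

Section TopologicalDual.
Context {R : realType} (V : normedModType R).

Definition topdual_pred : {pred V -> R^o} :=
  fun phi => `[< linear phi /\ continuous phi >].

Record topdual := TopDual {
  topdual_fun :> V -> R^o;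
  topdual_funP : topdual_fun \in topdual_pred }.

HB.instance Definition _ := [isSub for topdual_fun].
HB.instance Definition _ := [Choice of topdual by <:].

Fact topdual_submod_closed : submod_closed topdual_pred.
Proof.
split=> [|a phi psi].
  apply/asboolP; split=> [b x y|]; last exact: cst_continuous.
  by rewrite -[LHS]/(0 : R^o) -[RHS]/(b *: (0 : R^o) + (0 : R^o)) scaler0 addr0.
move=> /asboolP[lphi cphi] /asboolP[lpsi cpsi]; apply/asboolP; split.
  move=> b x y.
  rewrite -[LHS]/(a *: phi (b *: x + y) + psi (b *: x + y)) lphi lpsi.
  rewrite -[RHS]/(b *: (a *: phi x + psi x) + (a *: phi y + psi y)).
  by rewrite !scalerDr !scalerA (mulrC b) addrACA.
move=> x; apply: cvgD; last exact: cpsi.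
by apply: cvgZ; [exact: cvg_cst|exact: cphi].
Qed.

HB.instance Definition _ :=
  GRing.isSubmodClosed.Build R (V -> R^o) topdual_pred topdual_submod_closed.
HB.instance Definition _ := [SubChoice_isSubLmodule of topdual by <:].

Lemma topdual_continuous (phi : topdual) : continuous phi.
Proof. by have /asboolP[] := topdual_funP phi. Qed.

Fact topdual_linear (phi : topdual) : linear phi.
Proof. by have /asboolP[] := topdual_funP phi. Qed.

HB.instance Definition _ (phi : topdual) :=
  GRing.isLinear.Build R V R^o *:%R phi (topdual_linear phi).

Definition dual_norm (N : V -> R) (phi : topdual) : R :=
  sup [set `|phi w| | w in [set w | N w <= 1]].

Local Notation opnorm := (dual_norm (fun w : V => `|w|)).

Lemma opnorm_has_sup (phi : topdual) :
  has_sup [set `|phi w| | w in [set w : V | `|w| <= 1]].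
Proof.
split; first by exists `|phi 0|; exists 0; rewrite //= normr0.
have /linear_bounded_continuous/bounded_funP/(_ 1)[M hM] :=
  @topdual_continuous phi.
by exists M => _ [w /= w1 <-]; exact: hM.
Qed.

Lemma opnorm_ub (phi : topdual) (w : V) : `|w| <= 1 -> `|phi w| <= opnorm phi.
Proof.
by move=> w1; apply: ub_le_sup; [case: (opnorm_has_sup phi)|exists w].
Qed.

Lemma opnorm_le (phi : topdual) (M : R) :
  (forall w : V, `|w| <= 1 -> `|phi w| <= M) -> opnorm phi <= M.
Proof.
move=> h; apply: ge_sup; first by case: (opnorm_has_sup phi).
by move=> _ [w /= w1 <-]; exact: h.
Qed.

Fact opnormD (phi psi : topdual) :
  opnorm (phi + psi) <= opnorm phi + opnorm psi.
Proof.
apply: opnorm_le => w w1; rewrite -[X in `|X|]/(phi w + psi w).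
by apply: (le_trans (ler_normD _ _)); apply: lerD; exact: opnorm_ub.
Qed.

Fact opnormZ (l : R) (phi : topdual) : opnorm (l *: phi) = `|l| * opnorm phi.
Proof.
have le_opnormZ (a : R) (psi : topdual) :
    opnorm (a *: psi) <= `|a| * opnorm psi.
  apply: opnorm_le => w w1; rewrite -[X in `|X|]/(a * psi w) normrM.
  by apply: ler_wpM2l => //; exact: opnorm_ub.
apply/eqP; rewrite eq_le le_opnormZ /=.
have [->|l0] := eqVneq l 0.
  rewrite normr0 mul0r (le_trans _ (opnorm_ub (w := 0) _ _)) ?normr0//.
have := le_opnormZ l^-1 (l *: phi).
rewrite scalerA mulVf// scale1r normfV ler_pdivlMl ?normr_gt0//.
Qed.

Fact opnorm_eq0 (phi : topdual) : opnorm phi = 0 -> phi = 0.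
Proof.
move=> phi0; apply: val_inj; apply/funext => w /=.
have [->|w0] := eqVneq w 0; first by rewrite linear0.
have := @opnorm_ub phi (`|w|^-1 *: w).
rewrite normrZ normfV normr_id mulVf ?normr_eq0// phi0 linearZ/= normrM.
rewrite pmulr_rle0 ?normr_gt0 ?invr_neq0 ?normr_eq0// normr_le0.
by move=> /(_ (lexx _))/eqP.
Qed.

HB.instance Definition _ :=
  Lmodule_isNormed.Build R topdual opnormD opnormZ opnorm_eq0.

End TopologicalDual.

Arguments dual_norm {R V} N phi.

(* The inner product inducing the norm of E; a real Hilbert space is a
   completeNormedModType with such a form. *)
Definition inner_product {R : realType} (E : normedModType R)
    (dot : {dot E for idfun}) : Prop :=
  forall x : E, dot x x = `|x| ^+ 2.

(* V is seen inside H through emb.  The identification of H with its dual is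
   the pairing h |-> (w |-> (h, emb w)_H). *)
Definition gelfand_embedding {R : realType} (V H : normedModType R)
    (emb : {linear V -> H}) : Prop :=
  [/\ continuous emb, injective emb & dense (range emb)].

Definition coercive {R : realType} (V : normedModType R)
    (F : V -> topdual V) : Prop :=
  exists2 alpha : R, 0 < alpha & forall u : V, alpha * `|u| ^+ 2 <= F u u.

Definition energy_norm {R : realType} (V : normedModType R)
    (F : V -> topdual V) (u : V) : R :=
  Num.sqrt (F u u).

Section Bochner.
Context d (X : measurableType d) {R : realType}
  (mu : {measure set X -> \bar R}) (E : normedModType R).

Definition strongly_measurable (D : set X) (f : X -> E) : Prop :=
  exists s : nat -> X -> E,
    (forall n, finite_set (s n @` D) /\
       forall y, measurable (D `&` s n @^-1` [set y])) /\
    {ae mu, forall x, D x -> s ^~ x @ \oo --> f x}.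

Definition bochner_L2 (D : set X) (f : X -> E) : Prop :=
  strongly_measurable D f /\
  (\int[mu]_(x in D) (`|f x| ^+ 2)%:E < +oo)%E.

End Bochner.

Section FractionalCalculus.
Context {R : realType}.

(* Euler's Gamma function; meaningful for 0 < s. *)
Definition Gamma (s : R) : R :=
  \int[lebesgue_measure]_(t in `]0, +oo[) (t `^ (s - 1) * expR (- t)).

Definition frac_integral (sigma : R) (g : R -> R) (t : R) : R :=
  (Gamma sigma)^-1 *
  \int[lebesgue_measure]_(r in `[0, t]) ((t - r) `^ (sigma - 1) * g r).

Definition frac_weight (gamma : R) (j : nat) : R :=
  j.+1%:R `^ (1 - gamma) - j%:R `^ (1 - gamma).

(* frac_diff gamma tau phi k is delta^gamma phi^{k+1}. *)
Definition frac_diff (E : lmodType R) (gamma tau : R) (phi : nat -> E)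
    (k : nat) : E :=
  (Gamma (2 - gamma))^-1 *:
  \sum_(0 <= j < k.+1)
    (frac_weight gamma j * tau `^ (- gamma)) *:
      (phi (k.+1 - j)%N - phi (k - j)%N).

Definition pw_const (E : Type) (tau : R) (phi : nat -> E) (t : R) : E :=
  phi `|Num.ceil (t / tau)|%N.

Lemma pw_constE (E : Type) (tau : R) (phi : nat -> E) (l : nat) (t : R) :
  0 < tau -> l%:R * tau < t <= l.+1%:R * tau -> pw_const tau phi t = phi l.+1.
Proof.
move=> tau0 /andP[lt tl]; rewrite /pw_const.
suff -> : Num.ceil (t / tau) = l.+1 by [].
apply: ceil_def; rewrite ltr_pdivlMr// ler_pdivrMr//.
rewrite -[l.+1%:~R]/(l.+1%:R) tl (_ : l.+1%:Z - 1 = l) ?lt//.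
by rewrite -addn1 PoszD addrK.
Qed.

(* The square of the l^2(X) norm, a being the sequence of the X-norms. *)
Definition l2_normsq (tau : R) (K : nat) (a : nat -> R) : R :=
  \sum_(1 <= k < K.+1) tau * a k ^+ 2.

End FractionalCalculus.

(* The sequence is U in H; for k >= 1 its terms are those of UV in V, and only
   the indices up to K are constrained. *)
Definition implicit_scheme {R : realType} (V H : normedModType R)
    (dotH : {dot H for idfun}) (emb : {linear V -> H}) (F : V -> topdual V)
    (gamma tau : R) (K : nat) (u0 : H) (f : R -> topdual V)
    (U : nat -> H) (UV : nat -> V) : Prop :=
  U 0%N = u0 /\
  forall k, (k < K)%N ->
    U k.+1 = emb (UV k.+1) /\
    forall W : V,
      dotH (frac_diff gamma tau U k) (emb W) + F (UV k.+1) W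
      = f (k.+1%:R * tau) W.

(* Main.v *)
(* Testing with W = 2 tau U^{k+1} and Young's inequality reduce the bound to
   2 (delta^gamma U^{k+1}, U^{k+1}) >= delta^gamma |U^{k+1}|^2, which
   holds by Abel summation because the weights a_j are nonnegative and
   decreasing.  Summing over k, the double sum of backward differences
   telescopes to sum_j a_j (|U^{K-j}|^2 - |U^0|^2); since
   int_{t_{l-1}}^{t_l} (T - r)^(-gamma) dr = tau^(1-gamma) a_{K-l} / (1-gamma)
   and Gamma(2-gamma) = (1-gamma) Gamma(1-gamma), this is exactly the
   difference of the two fractional integrals. *)
Require Import Defs.
From HB Require Import structures.
From mathcomp Require Import all_boot all_order all_algebra sesquilinear.
From mathcomp Require Import all_classical all_reals all_analysis.
From mathcomp Require Import measurable_realfun ring lra.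
Import Order.TTheory GRing.Theory Num.Theory numFieldNormedType.Exports.
Local Open Scope classical_set_scope.
Local Open Scope ring_scope.

(** * Integrals of power functions with an endpoint singularity *)

Section FractionalIntegrals.
Set Implicit Arguments.
Unset Strict Implicit.
Context {R : realType}.
Local Notation mu := (@lebesgue_measure R).

Lemma ge0_continuous_FTC2_oo (f F : R -> R) (a b : R) : a < b ->
  {in `]a, b[%R, forall x, 0 <= f x} -> {in `]a, b[%R, continuous f} ->
  derivable_oo_LRcontinuous F a b -> {in `]a, b[%R, F^`()%classic =1 f} ->
  (\int[mu]_(x in `]a, b[) (f x)%:E = (F b - F a)%:E)%E.
Proof.
move=> ab f_ge0 cf [dF Fa Fb] F'f.
(* The factor 1/3 keeps [a + h n < b - h n] already at [n = 0]. *)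
pose h n : R := (b - a) / 3 * n.+1%:R^-1.
have ba3 : 0 < (b - a) / 3 by rewrite divr_gt0// subr_gt0.
have h_gt0 n : 0 < h n by rewrite mulr_gt0// invr_gt0.
have h_le n : h n <= (b - a) / 3.
  by rewrite ler_piMr ?(ltW ba3)// invf_le1// ler1n.
have h_dec m n : (m <= n)%N -> h n <= h m.
  by move=> mn; rewrite ler_wpM2l ?(ltW ba3)// lef_pV2 ?posrE// ler_nat.
have h0 : h n @[n --> \oo] --> 0.
  rewrite -[X in _ --> X](mulr0 ((b - a) / 3)).
  by apply: cvgMl_tmp; exact: cvg_harmonic.
have itvS n x : x \in `[a + h n, b - h n]%R -> x \in `]a, b[%R.
  by have := h_gt0 n; rewrite !in_itv/= => hn /andP[? ?]; apply/andP; split; lra.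
have cF x : x \in `]a, b[%R -> {for x, continuous F}.
  by move=> xab; apply/differentiable_continuous/derivable1_diffP/dF.
have FTC n : (\int[mu]_(x in `[(a + h n)%R, (b - h n)%R]) (f x)%:E =
              (F (b - h n) - F (a + h n))%:E)%E.
  have uv : a + h n < b - h n by have := h_le n; lra.
  rewrite EFinB; apply: continuous_FTC2 => //.
  - apply: continuous_in_subspaceT => x; rewrite inE/= => xn.
    exact: cf (itvS _ _ xn).
  - split=> [x xn| |].
    + by apply: dF; apply: itvS (subset_itv_oo_cc xn).
    + apply: cvg_at_right_filter; apply: cF; apply: (itvS n).
      by rewrite in_itv/= lexx ltW.
    + apply: cvg_at_left_filter; apply: cF; apply: (itvS n).
      by rewrite in_itv/= lexx ltW.
  - by move=> x xn; apply: F'f; apply: itvS (subset_itv_oo_cc xn).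
have bigE : \bigcup_n `[a + h n, b - h n]%classic = `]a, b[%classic :> set R.
  apply/seteqP; split => x /=; first by move=> [n _] /itvS.
  rewrite in_itv/= => /andP[ax xb].
  have e0 : 0 < Num.min (x - a) (b - x) by rewrite lt_min !subr_gt0 ax.
  have /cvgrPdist_lt/(_ _ e0)[n _ /(_ n (leqnn n))] := h0.
  rewrite sub0r normrN gtr0_norm// lt_min => /andP[? ?].
  by exists n => //=; rewrite in_itv/=; apply/andP; split; lra.
have c1 : (\int[mu]_(x in `[(a + h n)%R, (b - h n)%R]) (f x)%:E @[n --> \oo] -->
           \int[mu]_(x in `]a, b[) (f x)%:E)%E.
  rewrite -bigE; apply: ge0_nondecreasing_set_cvg_integral => //=.
  - move=> m n mn; apply/subsetPset; apply: subset_itv; rewrite bnd_simp.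
      by rewrite lerD2l h_dec.
    by rewrite lerD2l lerN2 h_dec.
  - move=> n; apply/measurable_EFinP.
    apply: (@measurable_funS _ _ _ _ `]a, b[) => //; first by move=> x /itvS.
    apply: open_continuous_measurable_fun => // x; rewrite inE => xab.
    exact: cf.
  - by move=> n x /itvS xab; rewrite lee_fin f_ge0.
have c2 : ((F (b - h n) - F (a + h n))%:E @[n --> \oo] --> (F b - F a)%:E)%E.
  apply: cvg_EFin; first by near=> n.
  apply: (@cvgB _ R^o).
  - move/cvg_at_leftP: Fb; apply; split=> [n|].
      by rewrite ltrBlDr ltrDl.
    by rewrite -[X in _ --> X]subr0; apply: cvgB => //; exact: cvg_cst.
  - move/cvg_at_rightP: Fa; apply; split=> [n|]; first by rewrite ltrDl.
    by rewrite -[X in _ --> X]addr0; apply: cvgD => //; exact: cvg_cst.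
apply: cvg_unique c1 _ => //; apply: cvg_trans c2.
by apply: near_eq_cvg; near=> n; rewrite FTC.
Unshelve. all: by end_near. Qed.

Lemma powR_continuous_gt0 (s : R) : {in `]0, +oo[%R, continuous (@powR R ^~ s)}.
Proof.
move=> x x0; apply/differentiable_continuous/derivable1_diffP.
exact: derivable_powR.
Qed.

Lemma powR_right_continuous (s x : R) : 0 < s -> 0 <= x ->
  y `^ s @[y --> x^'+] --> x `^ s.
Proof.
move=> s0; rewrite le_eqVlt => /predU1P[<-|x0].
  by rewrite powR0 ?gt_eqF//; exact: powR_cvg0.
by apply: cvg_at_right_filter; apply: powR_continuous_gt0; rewrite in_itv/= x0.
Qed.

Lemma derivable_powR_oo (s a b : R) : 0 < s -> 0 <= a -> a < b ->
  derivable_oo_LRcontinuous (@powR R ^~ s) a b.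
Proof.
move=> s0 a0 ab; split.
- move=> x; rewrite in_itv/= => /andP[ax _]; apply: derivable_powR.
  by rewrite in_itv/= (le_lt_trans a0).
- exact: powR_right_continuous.
- apply: cvg_at_left_filter; apply: powR_continuous_gt0.
  by rewrite in_itv/= (le_lt_trans a0).
Qed.

Lemma integral_powR (s a b : R) : 0 < s -> 0 <= a -> a <= b ->
  (\int[mu]_(x in `]a, b[) (s * x `^ (s - 1))%:E = (b `^ s - a `^ s)%:E)%E.
Proof.
move=> s0 a0; rewrite le_eqVlt => /predU1P[<-|ab].
  by rewrite set_itvoo0 ?integral_set0 ?subrr.
have pos x : x \in `]a, b[%R -> x \in `]0, +oo[%R.
  by rewrite !in_itv/= andbT => /andP[ax _]; exact: le_lt_trans ax.
apply: (@ge0_continuous_FTC2_oo _ (@powR R ^~ s)) => //.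
- by move=> x _; rewrite mulr_ge0 ?powR_ge0// ltW.
- move=> x /pos x0; apply: (@cvgM R); first exact: cvg_cst.
  exact: powR_continuous_gt0.
- exact: derivable_powR_oo.
- by move=> x /pos; exact: powR_derive1.
Qed.

Lemma integral_powR_reflected (s T a b : R) : 0 < s -> a <= b -> b <= T ->
  (\int[mu]_(x in `]a, b[) ((T - x) `^ (s - 1))%:E =
   (((T - a) `^ s - (T - b) `^ s) / s)%:E)%E.
Proof.
move=> s0; rewrite le_eqVlt => /predU1P[<- _|ab bT].
  by rewrite set_itvoo0 ?integral_set0 ?subrr ?mul0r.
have pos x : x \in `]a, b[%R -> T - x \in `]0, +oo[%R.
  by rewrite !in_itv/= andbT subr_gt0 => /andP[_ xb]; exact: lt_le_trans bT.
pose G (x : R) := - s^-1 * (T - x) `^ s.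
have dG (x : R) : 0 < T - x -> is_derive x 1 G ((T - x) `^ (s - 1)).
  move=> Tx; have dp := is_derive1_powR s Tx.
  have dT : is_derive x 1 (fun x : R => T - x) (-1).
    have := is_deriveB (is_derive_cst (T : R^o) x 1) (is_derive_id x 1).
    by rewrite sub0r.
  have := is_deriveZ (- s^-1) (@is_derive1_comp _ (@powR R ^~ s)
    (fun x => T - x) x _ _ dp dT).
  move=> /is_derive_eq; apply.
  rewrite -[_ *: _]/(- s^-1 * _); field.
  by rewrite gt_eqF.
have -> : ((T - a) `^ s - (T - b) `^ s) / s = G b - G a by rewrite /G; ring.
apply: (@ge0_continuous_FTC2_oo _ G) => //.
- by move=> x _; rewrite powR_ge0.
- move=> x /pos x0; apply: (@continuous_comp R^o R^o R^o (fun x => T - x)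
      (@powR R ^~ (s - 1))); last exact: powR_continuous_gt0.
  by apply: (@cvgB _ R^o); [exact: cvg_cst|exact: cvg_id].
- split.
  + move=> x /pos; rewrite in_itv/= andbT => Tx.
    exact: (@ex_derive _ _ _ _ _ _ _ (dG x Tx)).
  + apply: cvg_at_right_filter; apply/differentiable_continuous/derivable1_diffP.
    apply: (@ex_derive _ _ _ _ _ _ _ (dG a _)).
    by rewrite subr_gt0 (lt_le_trans ab).
  (* If [b = T], [G] need not be differentiable at [b]. Approaching [b] from the left makes
     [T - u n] approach [T - b >= 0] from the right, where the power is right-continuous. *)
  + apply/cvg_at_leftP => u [ub ucvg].
    apply: cvgMl_tmp.
    have := @powR_right_continuous s (T - b) s0; rewrite subr_ge0 => /(_ bT).
    move/cvg_at_rightP; apply; split=> [n|]; first by rewrite ltrD2l ltrN2.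
    by apply: cvgB => //; exact: cvg_cst.
- move=> x /pos; rewrite in_itv/= andbT => Tx.
  by rewrite derive1E; case: (dG x Tx).
Qed.

(** * Sign and monotonicity of the weights *)

Lemma frac_weight_ge0 (gamma : R) (j : nat) : gamma < 1 ->
  0 <= frac_weight gamma j.
Proof.
move=> g1; rewrite /frac_weight subr_ge0 ge0_ler_powR ?nnegrE ?ler_nat//.
by rewrite subr_ge0 ltW.
Qed.

Lemma frac_weight_decr (gamma : R) (j : nat) : 0 < gamma < 1 ->
  frac_weight gamma j.+1 <= frac_weight gamma j.
Proof.
move=> /andP[g0 g1].
pose s := 1 - gamma; have s0 : 0 < s by rewrite subr_gt0.
have mvt (i : nat) : exists2 c : R, i%:R < c < i.+1%:R &
    frac_weight gamma i = s * c `^ (s - 1).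
  have ii : i%:R < i.+1%:R :> R by rewrite ltr_nat.
  have [c||c] := @MVT R (@powR R ^~ s) (fun x => s * x `^ (s - 1)) _ _ ii.
  - rewrite in_itv/= => /andP[ic _]; apply: is_derive1_powR.
    exact: le_lt_trans ic.
  - exact/derivable_oo_LRcontinuous_within/derivable_powR_oo.
  - rewrite in_itv/= => ic E; exists c => //; rewrite /frac_weight E.
    by rewrite -natrB// subSnn mulr1.
have [c /andP[jc cj] ->] := mvt j; have [d /andP[jd _] ->] := mvt j.+1.
have c0 : 0 < c by exact: le_lt_trans jc.
have cd : c < d := lt_trans cj jd.
have d0 := lt_trans c0 cd.
rewrite ler_wpM2l ?(ltW s0)//.
have -> : s - 1 = - gamma by rewrite /s; ring.
rewrite !powRN lef_pV2 ?posrE ?powR_gt0//.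
by rewrite ge0_ler_powR ?nnegrE ?ltW.
Qed.

(** * The functional equation of the Gamma function *)

Lemma integral_expRN (a : R) :
  (\int[mu]_(t in `]a, +oo[) (expR (- t))%:E = (expR (- a))%:E)%E.
Proof.
have cexp : continuous (fun x : R => expR (- x)).
  move=> x; apply: continuous_comp; first exact: opp_continuous.
  exact: continuous_expR.
rewrite integral_itv_obnd_cbnd; last first.
  apply/measurable_EFinP; apply: measurable_funTS.
  exact: continuous_measurable_fun.
have dexp (x : R) : is_derive x 1 (fun x => - expR (- x)) (expR (- x)).
  have := is_deriveN (is_derive1_comp (is_derive_expR (- x)) (is_deriveNid x 1)).
  by rewrite mulrN1 opprK.
transitivity (0%:E - (- expR (- a))%:E)%E; last by rewrite EFinN oppeK add0e.
apply: (@ge0_continuous_FTC2y _ _ (fun x => - expR (- x))) => //.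
- by apply: continuous_subspaceT.
- rewrite -oppr0; apply: (@cvgN _ R^o).
  exact: cvgr_expR.
- by apply: cvg_at_right_filter; apply: (@cvgN _ R^o); exact: cexp.
- by move=> x _; rewrite derive1E; case: (dexp x).
Qed.

(* Tonelli for s x^(s-1) e^(-t) on {0 < x < t}; no finiteness of the integrals
   is needed, both sides being 0 when they diverge. *)
Lemma GammaD1 (s : R) : 0 < s -> Gamma (1 + s) = s * Gamma s.
Proof.
move=> s0.
pose h (z : R * R) : R := if (0 < z.1) && (z.1 < z.2) then
  (s * z.1 `^ (s - 1)) * expR (- z.2) else 0.
have h_ge0 z : 0 <= h z.
  rewrite /h; case: ifP => // _.
  by rewrite !mulr_ge0 ?powR_ge0 ?expR_ge0// ltW.
have mpow (p : R) : measurable_fun setT (fun x : R => x `^ p).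
  exact: measurable_powR.
have mexp : measurable_fun setT (fun x : R => expR (- x)).
  by apply: measurableT_comp => //; exact: measurable_expR.
have mh : measurable_fun setT (EFin \o h).
  apply/measurable_EFinP; apply: measurable_fun_ifT => //.
  - apply: measurable_and; apply: measurable_fun_ltr => //.
  - apply: measurable_funM.
      by apply: measurable_funM => //; exact: measurableT_comp (mpow _) _.
    exact: measurableT_comp mexp _.
(* Integrating out [t] first leaves the integrand of [s * Gamma s]; integrating out [x] first, in
   [h2], leaves that of [Gamma (1 + s)]. *)
have h1 (x : R) : 0 < x ->
    (\int[mu]_t (h (x, t))%:E = (s * (x `^ (s - 1) * expR (- x)))%:E)%E.
  move=> x0; rewrite mulrA.
  transitivity (\int[mu]_(t in `]x, +oo[)
      ((s * x `^ (s - 1))%:E * (expR (- t))%:E))%E.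
    rewrite [RHS]integral_mkcond; apply: eq_integral => t _.
    rewrite patchE /h/= x0/= mem_setE in_itv/= andbT.
    by case: ltP.
  rewrite ge0_integralZl ?integral_expRN//.
  - by apply/measurable_EFinP; apply: measurable_funTS.
  - by rewrite lee_fin mulr_ge0 ?powR_ge0// ltW.
have h2 (t : R) : 0 < t ->
    (\int[mu]_x (h (x, t))%:E = (t `^ s * expR (- t))%:E)%E.
  move=> t0.
  transitivity (\int[mu]_(x in `]0%R, t[)
      ((s * x `^ (s - 1))%:E * (expR (- t))%:E))%E.
    rewrite [RHS]integral_mkcond; apply: eq_integral => x _.
    rewrite patchE /h/= mem_setE in_itv/=.
    by case: ifP.
  rewrite ge0_integralZr ?integral_powR ?(ltW t0)//.
  - by rewrite powR0 ?gt_eqF// subr0.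
  - by apply/measurable_EFinP; apply: measurable_funTS; apply: measurable_funM.
  - by move=> x _; rewrite lee_fin mulr_ge0 ?powR_ge0// ltW.
have E : (\int[mu]_(t in `]0%R, +oo[) (t `^ s * expR (- t))%:E =
          s%:E * \int[mu]_(x in `]0%R, +oo[) (x `^ (s - 1) * expR (- x))%:E)%E.
  rewrite -ge0_integralZl ?lee_fin ?(ltW s0)//; last 2 first.
  - apply/measurable_EFinP; apply: measurable_funTS.
    by apply: measurable_funM.
  - by move=> x _; rewrite lee_fin mulr_ge0 ?powR_ge0 ?expR_ge0.
  transitivity (\int[mu]_t \int[mu]_x (h (x, t))%:E)%E.
    rewrite integral_mkcond; apply: eq_integral => t _.
    rewrite patchE mem_setE in_itv/= andbT; case: ltP => t0; first by rewrite h2.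
    rewrite integral0_eq// => x _; rewrite /h /=.
    by case: ltP => //= x0; rewrite ltNge (le_trans t0 (ltW x0)).
  rewrite -(@fubini_tonelli _ _ _ _ _ mu mu (EFin \o h) mh)//.
  rewrite [RHS]integral_mkcond; apply: eq_integral => x _.
  rewrite patchE mem_setE in_itv/= andbT; case: ltP => x0; first by rewrite h1.
  by rewrite integral0_eq// => t _; rewrite /h /= ltNge x0.
rewrite /Gamma /Rintegral; have -> : 1 + s - 1 = s by ring.
rewrite E; case: (\int[mu]_(x in _) _)%E => [r| |] //=.
- by rewrite gt0_muley ?lte_fin//= mulr0.
- by rewrite gt0_muleNy ?lte_fin//= mulr0.
Qed.

(** * Fractional integrals of piecewise constant functions *)

(** Induction on the number of cells, with [T] fixed independently of [n]. Measurability is carried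
    along because splitting off the last cell requires it. *)
Lemma integral_kernel_pw_const (s tau T : R) (phi : nat -> R) (n : nat) :
  0 < s -> 0 < tau -> (forall l, 0 <= phi l) -> n%:R * tau <= T ->
  let g := fun r : R => (T - r) `^ (s - 1) * pw_const tau phi r in
  measurable_fun `]0, n%:R * tau] g /\
  (\int[mu]_(r in `]0%R, (n%:R * tau)%R]) (g r)%:E =
   (\sum_(0 <= l < n)
     ((T - l%:R * tau) `^ s - (T - l.+1%:R * tau) `^ s) / s * phi l.+1)%:E)%E.
Proof.
move=> s0 tau0 phi0 + g; elim: n => [_|n IHn nT].
  rewrite mul0r set_itvoc0 integral_set0 big_geq//; split=> //.
  exact: measurable_fun_set0.
have nn : n%:R * tau <= n.+1%:R * tau by rewrite ler_pM2r// ler_nat.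
have n0 : 0 <= n%:R * tau by rewrite mulr_ge0// ltW.
have [mg Ig] := IHn (le_trans nn nT).
have mk : measurable_fun setT (fun r : R => (T - r) `^ (s - 1)).
  have mp : measurable_fun setT (fun x : R => x `^ (s - 1)).
    exact: measurable_powR.
  apply: (measurableT_comp mp).
  by apply: measurable_funB.
have gE : {in `]n%:R * tau, n.+1%:R * tau]%classic,
    (fun r => (T - r) `^ (s - 1) * phi n.+1) =1 g}.
  by move=> r; rewrite inE/= in_itv/= => rn; rewrite /g (pw_constE _ tau0 rn).
have mgn : measurable_fun `]n%:R * tau, n.+1%:R * tau] g.
  apply: eq_measurable_fun gE _; apply: measurable_funTS.
  by apply: measurable_funM.
have U : `]0, n.+1%:R * tau]%classic =
    `]0, n%:R * tau] `|` `]n%:R * tau, n.+1%:R * tau] :> set R.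
  by apply: itv_bndbnd_setU; rewrite bnd_simp.
have mU : measurable_fun (`]0, n%:R * tau] `|` `]n%:R * tau, n.+1%:R * tau]) g.
  by apply/measurable_funU.
rewrite U; split=> //.
rewrite ge0_integral_setU//=; last 3 first.
- exact/measurable_EFinP.
- by move=> r _; rewrite lee_fin mulr_ge0 ?powR_ge0// /pw_const.
- apply/disj_setPRL => r /=; rewrite !in_itv/= => /andP[nr _].
  by apply/negP; rewrite negb_and -ltNge nr orbT.
rewrite Ig big_nat_recr//= EFinD; congr (_ + _)%E.
transitivity (\int[mu]_(r in `](n%:R * tau)%R, (n.+1%:R * tau)%R])
    (((T - r) `^ (s - 1))%:E * (phi n.+1)%:E))%E.
  by apply: eq_integral => r /gE <-; rewrite EFinM.
(* The right endpoint of the cell, which may be the singular point [T], is dropped as a null set. *)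
rewrite integral_itv_bndoo; last first.
  apply/measurable_EFinP; apply: measurable_funTS.
  by apply: measurable_funM.
rewrite ge0_integralZr//; last 3 first.
- by apply/measurable_EFinP; apply: measurable_funTS.
- by move=> r _; rewrite lee_fin powR_ge0.
- by rewrite lee_fin.
by rewrite integral_powR_reflected// EFinM.
Qed.

Lemma frac_integral_pw_const (gamma tau : R) (phi : nat -> R) (K : nat) :
  gamma < 1 -> 0 < tau -> (forall l, 0 <= phi l) ->
  frac_integral (1 - gamma) (pw_const tau phi) (K%:R * tau) =
  (Gamma (2 - gamma))^-1 * tau `^ (1 - gamma) *
  \sum_(0 <= j < K) frac_weight gamma j * phi (K - j)%N.
Proof.
move=> g1 tau0 phi0; have s0 : 0 < 1 - gamma by rewrite subr_gt0.
have [mg Ig] := integral_kernel_pw_const s0 tau0 phi0 (lexx (K%:R * tau)).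
(* The point 0 is dropped: there [pw_const] takes the value [phi 0], not [phi 1]. *)
rewrite /frac_integral /Rintegral -integral_itv_obnd_cbnd; last first.
  exact/measurable_EFinP.
rewrite Ig/= [2 - gamma](_ : _ = 1 + (1 - gamma)); last by ring.
(* Reversing the sum counts cells backwards from the final time, which turns the kernel increments
   into [frac_weight]. The bound [j < K] is kept so that [K - j] is a true subtraction. *)
rewrite (GammaD1 s0) invfM big_nat_rev/= add0n !mulr_sumr big_nat [RHS]big_nat.
apply: eq_bigr => j /= jK.
rewrite subnSK//.
have pE (m : nat) : (m <= K)%N ->
    (K%:R * tau - (K - m)%:R * tau) `^ (1 - gamma) =
    tau `^ (1 - gamma) * m%:R `^ (1 - gamma).
  move=> mK; rewrite -powRM ?(ltW tau0)//; congr (_ `^ _).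
  by rewrite natrB//; ring.
by rewrite (pE j.+1 jK) (pE j (ltnW jK)) /frac_weight; ring.
Qed.

End FractionalIntegrals.

(** * Abel summation for the discrete fractional derivative *)

Section EnergyEstimates.
Set Implicit Arguments.
Unset Strict Implicit.
Context {R : realType}.

Lemma abel_sum_ge0 (a d : nat -> R) (n : nat) :
  (forall j, a j.+1 <= a j) -> (forall j, 0 <= a j) ->
  (forall j, 0 <= d j) -> d 0%N = 0 ->
  0 <= \sum_(0 <= j < n) a j * (d j.+1 - d j).
Proof.
move=> a_dec a_ge0 d_ge0 d0.
(* Bounding the sum by its boundary term, instead of 0, is what makes the induction close. *)
have step m : a m * d m.+1 <= \sum_(0 <= j < m.+1) a j * (d j.+1 - d j).
  elim: m => [|m IHm]; first by rewrite big_nat1 d0 subr0.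
  rewrite big_nat_recr//=.
  have : a m.+1 * d m.+1 <= a m * d m.+1 by rewrite ler_wpM2r.
  lra.
case: n => [|n]; first by rewrite big_geq.
exact: le_trans (mulr_ge0 (a_ge0 _) (d_ge0 _)) (step n).
Qed.

Lemma double_dot_le (H : normedModType R) (dot : {dot H for idfun}) (x y : H) :
  inner_product dot -> 2 * dot x y <= `|x| ^+ 2 + `|y| ^+ 2.
Proof.
move=> dotP; have := sqr_ge0 `|x - y|.
rewrite -!dotP linearBl/= !linearBr/= (hermC dot y x) /= expr0 mul1r.
lra.
Qed.

(** The right side minus the left is an Abel sum of increments of the squared distances from
    [phi k.+1] to the earlier terms, starting at distance 0. *)
Lemma dot_backward_difference_ge (H : normedModType R) (dot : {dot H for idfun})
    (a : nat -> R) (phi : nat -> H) (k : nat) :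
  inner_product dot ->
  (forall j, a j.+1 <= a j) -> (forall j, 0 <= a j) ->
  \sum_(0 <= j < k.+1)
     a j * (`|phi (k.+1 - j)%N| ^+ 2 - `|phi (k - j)%N| ^+ 2) <=
  2 * dot (\sum_(0 <= j < k.+1) a j *: (phi (k.+1 - j)%N - phi (k - j)%N))
          (phi k.+1).
Proof.
move=> dotP a_dec a_ge0.
(* d j = |phi^{k+1} - phi^{k+1-j}|^2, expanded. *)
pose d j := `|phi k.+1| ^+ 2 + `|phi (k.+1 - j)%N| ^+ 2
            - 2 * dot (phi (k.+1 - j)%N) (phi k.+1).
have d_ge0 j : 0 <= d j.
  have := double_dot_le (phi (k.+1 - j)%N) (phi k.+1) dotP.
  by rewrite /d; lra.
have d0 : d 0%N = 0 by rewrite /d subn0 dotP; ring.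
rewrite -subr_ge0; have := @abel_sum_ge0 a d k.+1 a_dec a_ge0 d_ge0 d0.
rewrite linear_sumlz/= mulr_sumr -sumrB.
suff -> : \sum_(0 <= j < k.+1) a j * (d j.+1 - d j) = \sum_(0 <= j < k.+1)
  (2 * dot (a j *: (phi (k.+1 - j)%N - phi (k - j)%N)) (phi k.+1) -
   a j * (`|phi (k.+1 - j)%N| ^+ 2 - `|phi (k - j)%N| ^+ 2)) by [].
apply: eq_bigr => j _; rewrite linearZl_LR/= linearBl/= /d subSS; ring.
Qed.

(** For each fixed lag [j] the differences telescope in [k], from [k = j] to [K - 1]. *)
Lemma sum_backward_differences (a phi : nat -> R) (K : nat) :
  \sum_(0 <= k < K) \sum_(0 <= j < k.+1)
     a j * (phi (k.+1 - j)%N - phi (k - j)%N) =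
  \sum_(0 <= j < K) a j * (phi (K - j)%N - phi 0%N).
Proof.
elim: K => [|K IHK]; first by rewrite !big_geq.
rewrite big_nat_recr//= IHK.
(* The added term [j = K] is zero; it aligns the range with that of the new row. *)
have -> : \sum_(0 <= j < K) a j * (phi (K - j)%N - phi 0%N) =
          \sum_(0 <= j < K.+1) a j * (phi (K - j)%N - phi 0%N).
  by rewrite [RHS]big_nat_recr//= subnn subrr mulr0 addr0.
by rewrite -big_split/=; apply: eq_bigr => j _; ring.
Qed.

(** * The energy norm and its dual norm *)

Section Energy.
Context (V : normedModType R) (F : {linear V -> topdual V})
  (F_coercive : coercive F).

Lemma coercive_ge0 (u : V) : 0 <= F u u.
Proof.
by have [c c_gt0 Fc] := F_coercive; rewrite (le_trans _ (Fc u))// mulr_ge0// ltW.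
Qed.

Lemma energy_normZ (c : R) (u : V) :
  energy_norm F (c *: u) = `|c| * energy_norm F u.
Proof.
rewrite /energy_norm.
have -> : F (c *: u) (c *: u) = c ^+ 2 * F u u.
  by rewrite !linearZ/= expr2 -mulrA.
by rewrite sqrtrM ?sqr_ge0// sqrtr_sqr.
Qed.

Lemma energy_norm_gt0 (u : V) : u != 0 -> 0 < energy_norm F u.
Proof.
have [c c_gt0 Fc] := F_coercive => u0; rewrite sqrtr_gt0 (lt_le_trans _ (Fc u))//.
by rewrite mulr_gt0// exprn_gt0// normr_gt0.
Qed.

Lemma dual_energy_norm_le (phi : topdual V) (u : V) :
  `|phi u| <= dual_norm (energy_norm F) phi * energy_norm F u.
Proof.
have [->|u0] := eqVneq u 0.
  by rewrite linear0 normr0 /energy_norm linear0 sqrtr0 mulr0.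
have Eu := energy_norm_gt0 u0.
rewrite -ler_pdivrMr//.
have -> : `|phi u| / energy_norm F u = `|phi ((energy_norm F u)^-1 *: u)|.
  by rewrite linearZ/= normrM normfV (gtr0_norm Eu) mulrC.
apply: ub_le_sup; last first.
  exists ((energy_norm F u)^-1 *: u) => //=.
  by rewrite energy_normZ gtr0_norm ?invr_gt0// mulVf// gt_eqF.
(* The supremum is meaningful only over a bounded set: coercivity puts the energy unit ball inside
   the norm ball of radius [(Num.sqrt c)^-1], where the continuous [phi] is bounded. *)
have [c c_gt0 Fc] := F_coercive.
have /linear_bounded_continuous/bounded_funP/(_ (Num.sqrt c)^-1)[M hM] :=
  @topdual_continuous _ _ phi.
exists M => _ [w /= w1 <-]; apply: hM.
rewrite -[_^-1]mul1r ler_pdivlMr ?sqrtr_gt0//; apply: le_trans w1.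
by rewrite mulrC -[`|w|]ger0_norm// -sqrtr_sqr -sqrtrM ?(ltW c_gt0)// ler_wsqrtr.
Qed.

(** With [p] the dual norm and [q] the energy norm, [phi u <= p * q] and [F u u = q ^+ 2], so this
    is [2 * p * q <= p ^+ 2 + q ^+ 2]. One copy of the energy survives, hence the unit constants of
    the final bound. *)
Lemma young_energy (phi : topdual V) (u : V) :
  2 * (phi u - F u u) <=
  dual_norm (energy_norm F) phi ^+ 2 - energy_norm F u ^+ 2.
Proof.
have := le_trans (ler_norm _) (dual_energy_norm_le phi u).
have -> : F u u = energy_norm F u ^+ 2 by rewrite sqr_sqrtr// coercive_ge0.
have := sqr_ge0 (dual_norm (energy_norm F) phi - energy_norm F u).
nra.
Qed.

End Energy.
End EnergyEstimates.

(** * The energy inequality of one time step and its sum over all steps *)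

Theorem theorem3p7 (R : realType) (V H : completeNormedModType R)
    (dotV : {dot V for idfun}) (dotH : {dot H for idfun})
    (dotV_inner : inner_product dotV) (dotH_inner : inner_product dotH)
    (emb : {linear V -> H}) (iota_gelfand : gelfand_embedding emb)
    (F : {linear V -> topdual V}) (F_continuous : continuous F)
    (F_coercive : coercive F)
    (T gamma : R) (T_gt0 : 0 < T) (gamma01 : 0 < gamma < 1)
    (u0 : H) (f : R -> topdual V)
    (f_L2 : bochner_L2 lebesgue_measure `[0, T] f)
    (K : nat) (K_gt0 : (0 < K)%N) (U : nat -> H) (UV : nat -> V) :
  let tau := T / K%:R in
  implicit_scheme dotH emb F gamma tau K u0 f U UV ->
  frac_integral (1 - gamma) (fun t => `|pw_const tau U t| ^+ 2) T
    + l2_normsq tau K (fun k => energy_norm F (UV k))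
  <= frac_integral (1 - gamma) (fun=> `|U 0%N| ^+ 2) T
    + l2_normsq tau K (fun k => dual_norm (energy_norm F) (f (k%:R * tau))).
Proof.
move=> tau [_ scheme]; have /andP[g0 g1] := gamma01.
have K0 : 0 < K%:R :> R by rewrite ltr0n.
have tau0 : 0 < tau by rewrite divr_gt0.
have TE : T = K%:R * tau by rewrite mulrC divfK// gt_eqF.
pose phi k := `|U k| ^+ 2; have phi0 k : 0 <= phi k by rewrite sqr_ge0.
pose c := (Gamma (2 - gamma))^-1 * tau `^ (1 - gamma).
have Gge0 : 0 <= Gamma (2 - gamma).
  by apply: Rintegral_ge0 => t _; rewrite mulr_ge0 ?powR_ge0 ?expR_ge0.
have c0 : 0 <= c by rewrite mulr_ge0 ?powR_ge0// invr_ge0.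
have IU : frac_integral (1 - gamma) (fun t => `|pw_const tau U t| ^+ 2) T =
    c * \sum_(0 <= j < K) frac_weight gamma j * phi (K - j)%N.
  by rewrite TE; exact: (@frac_integral_pw_const _ _ tau phi).
(* The constant is read as the interpolant of a constant sequence, so the same formula applies. *)
have IU0 : frac_integral (1 - gamma) (fun=> `|U 0%N| ^+ 2) T =
    c * \sum_(0 <= j < K) frac_weight gamma j * phi 0%N.
  by rewrite TE; exact: (@frac_integral_pw_const _ _ tau (fun=> phi 0%N)).
have step k : (k < K)%N ->
    c * \sum_(0 <= j < k.+1)
      frac_weight gamma j * (phi (k.+1 - j)%N - phi (k - j)%N) <=
    tau * dual_norm (energy_norm F) (f (k.+1%:R * tau)) ^+ 2
    - tau * energy_norm F (UV k.+1) ^+ 2.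
  move=> /scheme[Uk /(_ (UV k.+1)) sk].
  have := @dot_backward_difference_ge _ _ _ (frac_weight gamma) U k dotH_inner
    (fun j => frac_weight_decr j gamma01) (fun j => frac_weight_ge0 j g1).
  move=> /(ler_wpM2l c0) /le_trans; apply.
  pose D := \sum_(0 <= j < k.+1)
    frac_weight gamma j *: (U (k.+1 - j)%N - U (k - j)%N).
  have fdE : frac_diff gamma tau U k =
      ((Gamma (2 - gamma))^-1 * tau `^ (- gamma)) *: D.
    rewrite /frac_diff -scalerA /D [in RHS]scaler_sumr; congr (_ *: _).
    by apply: eq_bigr => j _; rewrite scalerA mulrC.
  (* The time step [tau] multiplying the tested equation converts the constant of [frac_diff] into
     that of the fractional integral. *)
  have cE : c = tau * ((Gamma (2 - gamma))^-1 * tau `^ (- gamma)).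
    rewrite /c powRD ?powRr1 ?(ltW tau0)//; first by ring.
    by rewrite (gt_eqF tau0) implybT.
  have := ler_wpM2l (ltW tau0)
    (young_energy F_coercive (f (k.+1%:R * tau)) (UV k.+1)).
  rewrite -mulrBr; apply: le_trans.
  (* By the scheme, the load minus the energy in [young_energy] is the product of the discrete
     derivative with [U k.+1]. *)
  rewrite -/D -sk addrK -Uk fdE [dotH (_ *: D) _]linearZl_LR/= cE.
  by rewrite le_eqVlt; apply/orP; left; apply/eqP; ring.
have := ler_sum_nat (m := 0%N) (n := K) (fun k kK => step k (proj2 (andP kK))).
(* After telescoping, the left side is the difference of [IU] and [IU0]; the shift by [big_add1]
   matches the sums over 1..K in [l2_normsq]. *)
rewrite -mulr_sumr sum_backward_differences sumrB.
under [X in c * X]eq_bigr do rewrite mulrBr.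
rewrite sumrB mulrBr IU IU0 /l2_normsq !big_add1/=.
lra.
Qed.
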